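(* Let $\mathfrak a$ be an idempotent ideal of $\mathbb{S}_n$ with $\mathfrak a\ne\mathbb{S}_n$. Then: (1) $\mathfrak a$ is a product $\mathfrak q_1\cdots\mathfrak q_s$ of pairwise incomparable idempotent prime ideals, and such a product is unique: if $\mathfrak a=\mathfrak q_1\cdots\mathfrak q_s=\mathfrak r_1\cdots\mathfrak r_t$ are two such products, then $s=t$ and $\mathfrak q_i=\mathfrak r_{\sigma(i)}$ for some permutation $\sigma$. (2) $\mathfrak a$ is an intersection $\mathfrak q_1\cap\cdots\cap\mathfrak q_s$ of pairwise incomparable idempotent prime ideals, unique in the same sense. (3) The sets of primes in (1) and (2) coincide, so $\mathfrak a=\mathfrak q_1\cdots\mathfrak q_s=\mathfrak q_1\cap\cdots\cap\mathfrak q_s$. (4) $\{\mathfrak q_1,\dots,\mathfrak q_s\}=\mathrm{Min}(\mathfrak a)$, the set of minimal primes over $\mathfrak a$. Hence $\mathfrak a=\prod_{\mathfrak p\in\mathrm{Min}(\mathfrak a)}\mathfrak p=\bigcap_{\mathfrak p\in\mathrm{Min}(\mathfrak a)}\mathfrak p$, and every minimal prime over $\mathfrak a$ is idempotent.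
   Context: $K$ is a field. $\mathbb{S}_n$ is the $K$-algebra generated by $x_1,\dots,x_n,y_1,\dots,y_n$ subject to the defining relations $y_ix_i=1$ for all $i$, and $[x_i,y_j]=[x_i,x_j]=[y_i,y_j]=0$ for all $i\ne j$. An ideal $I$ is idempotent if $I^2=I$. Two ideals are incomparable if neither contains the other. $\mathrm{Min}(\mathfrak a)$ denotes the set of prime ideals minimal among those containing $\mathfrak a$. *)

(* Defs.v *)
From HB Require Import structures.
From mathcomp Require Import all_boot all_order all_algebra.
Set Implicit Arguments. Unset Strict Implicit. Unset Printing Implicit Defensive.
Import GRing.Theory.
Local Open Scope ring_scope.

Section IdealDefs.
Variables (K : fieldType) (A : algType K).

Definition subI (I J : A -> Prop) : Prop := forall z, I z -> J z.
Definition eqI (I J : A -> Prop) : Prop := forall z, I z <-> J z.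
Definition fullI : A -> Prop := fun _ => True.

Definition is_ideal (I : A -> Prop) : Prop :=
  [/\ I 0,
      (forall a b, I a -> I b -> I (a + b)),
      (forall r a, I a -> I (r * a)) &
      (forall r a, I a -> I (a * r))].

Definition mulI (I J : A -> Prop) : A -> Prop :=
  fun z => exists (m : nat) (a b : 'I_m -> A),
    (forall k, I (a k) /\ J (b k)) /\ z = \sum_(k < m) a k * b k.

Fixpoint prodI (l : seq (A -> Prop)) : A -> Prop :=
  match l with
  | [::] => fullI
  | J0 :: l' => mulI J0 (prodI l')
  end.

Definition prodF (s : nat) (q : 'I_s -> A -> Prop) : A -> Prop :=
  prodI [seq q i | i <- enum 'I_s].

Definition capF (s : nat) (q : 'I_s -> A -> Prop) : A -> Prop :=
  fun z => forall i, q i z.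

Definition idempotent_ideal (I : A -> Prop) : Prop :=
  is_ideal I /\ eqI (mulI I I) I.

Definition proper_ideal (I : A -> Prop) : Prop :=
  is_ideal I /\ ~ eqI I fullI.

Definition prime_ideal (P : A -> Prop) : Prop :=
  proper_ideal P /\
  forall I J, is_ideal I -> is_ideal J -> subI (mulI I J) P -> subI I P \/ subI J P.

Definition min_prime_over (a P : A -> Prop) : Prop :=
  [/\ prime_ideal P, subI a P &
      forall Q, prime_ideal Q -> subI a Q -> subI Q P -> subI P Q].

Definition incomparable (I J : A -> Prop) : Prop := ~ subI I J /\ ~ subI J I.

Definition good_family (s : nat) (q : 'I_s -> A -> Prop) : Prop :=
  (forall i, prime_ideal (q i) /\ idempotent_ideal (q i)) /\
  (forall i j, i != j -> incomparable (q i) (q j)).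

Definition same_up_to_perm (s t : nat) (q : 'I_s -> A -> Prop)
    (r : 'I_t -> A -> Prop) : Prop :=
  s = t /\ exists sigma : 'I_s -> 'I_t, bijective sigma /\
                                       forall i, eqI (q i) (r (sigma i)).
End IdealDefs.

Section Jacobson.
Variables (K : fieldType) (n : nat).

Definition jac_rel (B : algType K) (x y : 'I_n -> B) : Prop :=
  (forall i, y i * x i = 1) /\
  (forall i j, i != j ->
     [/\ x i * y j = y j * x i, x i * x j = x j * x i & y i * y j = y j * y i]).

Definition alg_morph (A B : algType K) (f : A -> B) : Prop :=
  [/\ f 1 = 1, (forall a b, f (a + b) = f a + f b),
      (forall a b, f (a * b) = f a * f b) &
      (forall (k : K) a, f (k *: a) = k *: f a)].

Definition generates (A : algType K) (x y : 'I_n -> A) : Prop :=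
  forall S : A -> Prop,
    S 1 -> (forall a b, S a -> S b -> S (a + b)) ->
    (forall a b, S a -> S b -> S (a * b)) ->
    (forall (k : K) a, S a -> S (k *: a)) ->
    (forall i, S (x i) /\ S (y i)) -> forall z, S z.

(* (A, x, y) is a presentation of S_n = K<x_i, y_i | relations>:
   relations hold, x,y generate A, and A has the universal property. *)
Definition is_Sn (A : algType K) (x y : 'I_n -> A) : Prop :=
  [/\ jac_rel x y, generates x y &
      forall (B : algType K) (x' y' : 'I_n -> B), jac_rel x' y' ->
        exists f : A -> B, alg_morph f /\
          forall i, f (x i) = x' i /\ f (y i) = y' i].
End Jacobson.

(* Main.v *)
(* For a set [I] of indices let p_I be the ideal of the elements killed on the
   right by some monomial in the x_i, i in I; it is generated by the
   e_i = 1 - x_i y_i, i in I.  Every z in p_I satisfies z = z E for some E in p_I,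
   so p_I is idempotent and products of such ideals are intersections.

   The key point is that an idempotent ideal J is closed under the
   Hasse-Schmidt derivations attached to x_i -> x_i + s,
   y_i -> (1 + y_i s)^-1 y_i: by the Leibniz rule and J = J^2, induction on the
   order applies.  Hence, if J contains a polynomial in x_i with coefficients
   not involving x_i and y_i, it contains its top coefficient.  Cutting down by
   the corners e_i for i not in I and taking top coefficients for i in I, an
   idempotent ideal not contained in p_I is seen to contain the product of the
   e_i, i not in I.  Applied to J = p_I, a bilinear version of this shows that
   p_I is prime; applied to an idempotent ideal a, it shows that a is the
   intersection of the p_I containing it.  The rest is the standard theory of
   minimal primes over a finite product of primes. *)
Require Import Defs.
From HB Require Import structures.
From mathcomp Require Import all_boot all_order all_algebra.
From mathcomp Require Import boolp functions.
Set Implicit Arguments. Unset Strict Implicit. Unset Printing Implicit Defensive.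
Import GRing.Theory.
Local Open Scope ring_scope.

(** * Linear operators on sequences *)

Section SequenceEndomorphisms.
Variables (K : fieldType) (A : algType K).

(* The algebra of linear endomorphisms of the space of sequences of elements of
   [A]: the target of the two representations of [A] built below from the
   universal property. *)
Record seqEnd := SeqEnd {
  seqfun :> (nat -> A) -> (nat -> A);
  seqfunP : linear seqfun }.

HB.instance Definition _ := gen_eqMixin seqEnd.
HB.instance Definition _ := gen_choiceMixin seqEnd.

Lemma seqEndP (f g : seqEnd) : (forall u k, f u k = g u k) -> f = g.
Proof.
case: f g => [f fP] [g gP] /= fg.
have E : f = g by apply/funext => u; apply/funext => k.
by case: _ / E gP => gP; congr SeqEnd.
Qed.

Fact seqEnd_add_linear (f g : seqEnd) : linear (fun u => f u + g u).
Proof. by move=> a u v; rewrite !seqfunP scalerDr addrACA. Qed.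
Fact seqEnd_opp_linear (f : seqEnd) : linear (fun u => - f u).
Proof. by move=> a u v; rewrite seqfunP opprD scalerN. Qed.
Fact seqEnd_zero_linear : linear (fun _ : nat -> A => 0 : nat -> A).
Proof. by move=> a u v; rewrite scaler0 addr0. Qed.
Fact seqEnd_scale_linear (k : K) (f : seqEnd) : linear (fun u => k *: f u).
Proof. by move=> a u v; rewrite seqfunP scalerDr !scalerA mulrC. Qed.
Fact seqEnd_one_linear : linear (fun u : nat -> A => u).
Proof. by []. Qed.
Fact seqEnd_mul_linear (f g : seqEnd) : linear (fun u => f (g u)).
Proof. by move=> a u v; rewrite !seqfunP. Qed.

Lemma seqfunD (f : seqEnd) u v : f (u + v) = f u + f v.
Proof. by have := seqfunP f 1 u v; rewrite !scale1r. Qed.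
Lemma seqfun0 (f : seqEnd) : f 0 = 0.
Proof. by have := seqfunP f (-1) 0 0; rewrite scaler0 addr0 scaleN1r addNr. Qed.
Lemma seqfunZ (f : seqEnd) (k : K) u : f (k *: u) = k *: f u.
Proof. by have := seqfunP f k u 0; rewrite !addr0 seqfun0 addr0. Qed.

Definition seqEnd_add f g := SeqEnd (seqEnd_add_linear f g).
Definition seqEnd_opp f := SeqEnd (seqEnd_opp_linear f).
Definition seqEnd_zero := SeqEnd seqEnd_zero_linear.
Definition seqEnd_scale k f := SeqEnd (seqEnd_scale_linear k f).
Definition seqEnd_one := SeqEnd seqEnd_one_linear.
Definition seqEnd_mul f g := SeqEnd (seqEnd_mul_linear f g).

Fact seqEnd_addA : associative seqEnd_add.
Proof. by move=> f g h; apply: seqEndP => u k /=; rewrite addrA. Qed.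
Fact seqEnd_addC : commutative seqEnd_add.
Proof. by move=> f g; apply: seqEndP => u k /=; rewrite addrC. Qed.
Fact seqEnd_add0 : left_id seqEnd_zero seqEnd_add.
Proof. by move=> f; apply: seqEndP => u k /=; rewrite add0r. Qed.
Fact seqEnd_addN : left_inverse seqEnd_zero seqEnd_opp seqEnd_add.
Proof. by move=> f; apply: seqEndP => u k /=; rewrite addNr. Qed.
HB.instance Definition _ := GRing.isZmodule.Build seqEnd
  seqEnd_addA seqEnd_addC seqEnd_add0 seqEnd_addN.

Fact seqEnd_mulA : associative seqEnd_mul.
Proof. by move=> f g h; apply: seqEndP. Qed.
Fact seqEnd_mul1r : left_id seqEnd_one seqEnd_mul.
Proof. by move=> f; apply: seqEndP. Qed.
Fact seqEnd_mulr1 : right_id seqEnd_one seqEnd_mul.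
Proof. by move=> f; apply: seqEndP. Qed.
Fact seqEnd_mulDl : left_distributive seqEnd_mul seqEnd_add.
Proof. by move=> f g h; apply: seqEndP. Qed.
Fact seqEnd_mulDr : right_distributive seqEnd_mul seqEnd_add.
Proof. by move=> f g h; apply: seqEndP => u k /=; rewrite seqfunD. Qed.
Fact seqEnd_one_neq0 : seqEnd_one != 0.
Proof.
apply/eqP => /(congr1 (fun f : seqEnd => f (fun _ => 1) 0%N)) /= /eqP.
by rewrite oner_eq0.
Qed.
HB.instance Definition _ := GRing.Zmodule_isNzRing.Build seqEnd
  seqEnd_mulA seqEnd_mul1r seqEnd_mulr1 seqEnd_mulDl seqEnd_mulDr seqEnd_one_neq0.

Fact seqEnd_scaleA k l f :
  seqEnd_scale k (seqEnd_scale l f) = seqEnd_scale (k * l) f.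
Proof. by apply: seqEndP => u m /=; rewrite scalerA. Qed.
Fact seqEnd_scale1 : left_id 1 seqEnd_scale.
Proof. by move=> f; apply: seqEndP => u m /=; rewrite scale1r. Qed.
Fact seqEnd_scaleDr : right_distributive seqEnd_scale +%R.
Proof. by move=> k f g; apply: seqEndP => u m /=; rewrite scalerDr. Qed.
Fact seqEnd_scaleDl f : {morph seqEnd_scale^~ f : k l / k + l}.
Proof. by move=> k l; apply: seqEndP => u m /=; rewrite scalerDl. Qed.
HB.instance Definition _ := GRing.Zmodule_isLmodule.Build K seqEnd
  seqEnd_scaleA seqEnd_scale1 seqEnd_scaleDr seqEnd_scaleDl.

Fact seqEnd_scaleAl (k : K) (f g : seqEnd) : k *: (f * g) = (k *: f) * g.
Proof. by apply: seqEndP. Qed.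
HB.instance Definition _ := GRing.Lmodule_isLalgebra.Build K seqEnd seqEnd_scaleAl.
Fact seqEnd_scaleAr (k : K) (f g : seqEnd) : k *: (f * g) = f * (k *: g).
Proof. by apply: seqEndP => u m /=; rewrite seqfunZ. Qed.
HB.instance Definition _ := GRing.Lalgebra_isAlgebra.Build K seqEnd seqEnd_scaleAr.

Lemma seqfun_add (f g : seqEnd) u k : (f + g) u k = f u k + g u k.
Proof. by []. Qed.
Lemma seqfun_mul (f g : seqEnd) u : (f * g) u = f (g u).
Proof. by []. Qed.
Lemma seqfun_one u : (1 : seqEnd) u = u.
Proof. by []. Qed.
Lemma seqfun_scale c (f : seqEnd) u k : (c *: f) u k = c *: f u k.
Proof. by []. Qed.

Fact lmul_linear (a : A) : linear (fun (u : nat -> A) k => a * u k).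
Proof. by move=> c u v; apply/funext => k; rewrite [LHS]mulrDr -scalerAr. Qed.
Definition lmulE a := SeqEnd (lmul_linear a).

Fact shift_linear : linear (fun (u : nat -> A) k => if k is l.+1 then u l else 0).
Proof.
move=> c u v; apply/funext => -[|k] //=.
by rewrite -[RHS]/(c *: (0 : A) + 0) scaler0 addr0.
Qed.
(** On power series this is multiplication by [s]; [unshiftE] is a left inverse of it, so the pair
    satisfies the relation [y x = 1]. *)
Definition shiftE := SeqEnd shift_linear.

Fact unshift_linear : linear (fun (u : nat -> A) k => u k.+1).
Proof. by []. Qed.
Definition unshiftE := SeqEnd unshift_linear.

(* Power series division: [geom b u] is [(1 + b s)^-1 b u], where a sequence
   stands for the power series in [s] with these coefficients. *)
Fixpoint geom (b : A) (u : nat -> A) (k : nat) : A :=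
  if k is l.+1 then b * u k - b * geom b u l else b * u 0%N.
Fact geom_linear b : linear (geom b).
Proof.
move=> c u v; apply/funext => k.
suff E : geom b (c *: u + v) k = c *: geom b u k + geom b v k by rewrite E.
elim: k => [|k IH] /=; rewrite ?IH !mulrDr -!scalerAr // scalerBr opprD addrACA.
by congr (_ + _ + _).
Qed.
Definition geomE b := SeqEnd (geom_linear b).

Lemma lmulEE a u k : lmulE a u k = a * u k.
Proof. by []. Qed.
Lemma lmul_shiftE a u k :
  (lmulE a + shiftE) u k = a * u k + (if k is l.+1 then u l else 0).
Proof. by []. Qed.
Lemma geomE0 b u : geomE b u 0%N = b * u 0%N.
Proof. by []. Qed.
Lemma geomES b u k : geomE b u k.+1 = b * u k.+1 - b * geomE b u k.
Proof. by []. Qed.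

End SequenceEndomorphisms.

(** * Products of ideals, and uniqueness of families of incomparable primes *)

Section Ideals.
Variables (K : fieldType) (A : algType K).
Implicit Types (I J L P : A -> Prop).

Lemma mulI_mem I J a b : I a -> J b -> mulI I J (a * b).
Proof.
move=> Ia Jb; exists 1%N, (fun _ => a), (fun _ => b); split=> //.
by rewrite big_ord1.
Qed.

Lemma mulI_sub I J L : is_ideal L -> (forall a b, I a -> J b -> L (a * b)) ->
  subI (mulI I J) L.
Proof.
move=> [L0 LD _ _] H z [m [a [b [Hab ->]]]].
by apply: big_ind => // k _; have [? ?] := Hab k; apply: H.
Qed.

Lemma mulI_ideal I J : is_ideal I -> is_ideal J -> is_ideal (mulI I J).
Proof.
move=> [I0 ID Il Ir] [J0 JD Jl Jr]; split.
- by rewrite -(mul0r 0); apply: mulI_mem.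
- move=> _ _ [m [a [b [Hab ->]]]] [l [c [d [Hcd ->]]]].
  exists (m + l)%N, (fun k => match fintype.split k with inl i => a i | inr j => c j end),
    (fun k => match fintype.split k with inl i => b i | inr j => d j end).
  split=> [k|]; first by case: fintype.split.
  rewrite big_split_ord /=; congr (_ + _); apply: eq_bigr => k _.
    by rewrite -[lshift l k]/(unsplit (inl k)) unsplitK.
  by rewrite -[rshift m k]/(unsplit (inr k)) unsplitK.
- move=> r _ [m [a [b [Hab ->]]]]; exists m, (fun k => r * a k), b; split=> [k|].
    by have [? ?] := Hab k; split=> //; apply: Il.
  by rewrite mulr_sumr; apply: eq_bigr => k _; rewrite mulrA.
move=> r _ [m [a [b [Hab ->]]]]; exists m, a, (fun k => b k * r); split=> [k|].
  by have [? ?] := Hab k; split=> //; apply: Jr.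
by rewrite mulr_suml; apply: eq_bigr => k _; rewrite mulrA.
Qed.

Section Products.
Variables (T : eqType) (q : T -> A -> Prop).
Hypothesis q_ideal : forall i, is_ideal (q i).

Lemma prodI_ideal s : is_ideal (prodI [seq q i | i <- s]).
Proof. by elim: s => [|i s IH] //=; apply: mulI_ideal. Qed.

Lemma prodI_sub s i : i \in s -> subI (prodI [seq q j | j <- s]) (q i).
Proof.
elim: s => [|j s IH] //=; rewrite inE; have [-> _|_ /= /IH H] := eqVneq i j.
  by apply: mulI_sub => // a b Ha _; have [_ _ _ Hr] := q_ideal j; apply: Hr.
by apply: mulI_sub => // a b _ /H Hb; have [_ _ Hl _] := q_ideal i; apply: Hl.
Qed.

Lemma prime_prodI P s : prime_ideal P -> subI (prodI [seq q i | i <- s]) P ->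
  exists2 i, i \in s & subI (q i) P.
Proof.
(* The empty product is the whole algebra, which a proper ideal cannot contain. *)
move=> [[_ Pne] Pp]; elim: s => [|i s IH] /= H; first by case: Pne => z; split=> // /H.
have [qP|/IH[j js jP]] := Pp _ _ (q_ideal i) (prodI_ideal s) H.
  by exists i; rewrite ?mem_head.
by exists j; rewrite // inE js orbT.
Qed.

End Products.

(** Every member of one family contains [a], hence the product of the other family, hence a member
    of it. Going back and forth returns to the same member by incomparability, so the inclusions are
    equalities. Since [a] is only placed between the product and the members, both products and
    intersections are covered. *)
Lemma good_family_unique a s t (q : 'I_s -> A -> Prop) (r : 'I_t -> A -> Prop) :
  good_family q -> good_family r ->
  (forall i, subI a (q i)) -> (forall j, subI a (r j)) ->
  subI (prodF q) a -> subI (prodF r) a -> same_up_to_perm q r.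
Proof.
have inj m (u : 'I_m -> A -> Prop) i j : good_family u -> subI (u i) (u j) -> i = j.
  by move=> [_ U] uij; case: (eqVneq i j) => // /U[].
have below m (u : 'I_m -> A -> Prop) P : good_family u -> prime_ideal P ->
    subI a P -> subI (prodF u) a -> exists i, subI (u i) P.
  move=> [U _] HP aP ua.
  have [||i _ uP] := @prime_prodI _ u _ P (enum 'I_m) HP; last by exists i.
    by move=> i; have [[[]]] := U i.
  by move=> z /ua /aP.
have match_ m l (u : 'I_m -> A -> Prop) (v : 'I_l -> A -> Prop) :
    good_family u -> good_family v ->
    (forall i, subI a (u i)) -> (forall j, subI a (v j)) ->
    subI (prodF u) a -> subI (prodF v) a ->
    exists f : 'I_m -> 'I_l, forall i, eqI (u i) (v (f i)).
  move=> Hu Hv au av ua va.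
  suff /choice[f Hf] : forall i, exists j, eqI (u i) (v j) by exists f.
  move=> i.
  have [j vu] := below _ v _ Hv (Hu.1 i).1 (au i) va.
  have [k uv] := below _ u _ Hu (Hv.1 j).1 (av j) ua.
  have ki : k = i by apply: inj Hu _ => z /uv /vu.
  by rewrite ki in uv; exists j => z; split; [apply: uv|apply: vu].
move=> Hq Hr aq ar qa ra.
have [f Hf] := match_ _ _ q r Hq Hr aq ar qa ra.
have [g Hg] := match_ _ _ r q Hr Hq ar aq ra qa.
have fK : cancel f g.
  by move=> i; apply: inj Hq _ => z /(Hg (f i) z).2 /(Hf i z).2.
have gK : cancel g f.
  by move=> i; apply: inj Hr _ => z /(Hf (g i) z).2 /(Hg i z).2.
have f_bij : bijective f by exists g.
split; last by exists f.
by have := bij_eq_card f_bij; rewrite !card_ord.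
Qed.

End Ideals.

(** * Subalgebras on chosen generators, and monomials *)

Section OneSidedInverses.
Variables (K : fieldType) (n : nat) (A : algType K) (x y : 'I_n -> A).

(** Two index sets are needed: the Ore condition discards some [y i] but keeps every [x i], while
    later steps discard both generators of one index at a time. *)
Inductive subalg (X Y : {set 'I_n}) : A -> Prop :=
| subalg1 : subalg X Y 1
| subalgD a b : subalg X Y a -> subalg X Y b -> subalg X Y (a + b)
| subalgM a b : subalg X Y a -> subalg X Y b -> subalg X Y (a * b)
| subalgZ (k : K) a : subalg X Y a -> subalg X Y (k *: a)
| subalgX i : i \in X -> subalg X Y (x i)
| subalgY i : i \in Y -> subalg X Y (y i).

Inductive xmon (I : {set 'I_n}) : A -> Prop :=
| xmon1 : xmon I 1
| xmonX i m : i \in I -> xmon I m -> xmon I (x i * m).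

(* The preimage of the extension of [a] to the right localization at [xmon I]. *)
Definition sat (a : A -> Prop) (I : {set 'I_n}) (z : A) : Prop :=
  exists2 m, xmon I m & a (z * m).
Definition pI (I : {set 'I_n}) : A -> Prop := sat (eq^~ 0) I.
Definition e i : A := 1 - x i * y i.

Lemma subalg0 X Y : subalg X Y 0.
Proof. by rewrite -(scale0r 1); apply: subalgZ; apply: subalg1. Qed.

Lemma subalgS (X Y X' Y' : {set 'I_n}) z : X \subset X' -> Y \subset Y' ->
  subalg X Y z -> subalg X' Y' z.
Proof.
move=> sX sY; elim=> [|a b _ Ha _ Hb|a b _ Ha _ Hb|k a _ Ha|i iX|i iY].
- exact: subalg1.
- exact: subalgD.
- exact: subalgM.
- exact: subalgZ.
- by apply: subalgX; apply: (subsetP sX).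
- by apply: subalgY; apply: (subsetP sY).
Qed.

Lemma subalg_comm (X Y : {set 'I_n}) g z :
  (forall j, j \in X -> GRing.comm g (x j)) ->
  (forall j, j \in Y -> GRing.comm g (y j)) -> subalg X Y z -> GRing.comm g z.
Proof.
move=> gX gY; elim=> [|a b _ Ha _ Hb|a b _ Ha _ Hb|k a _ Ha|i iX|i iY].
- exact: commr1.
- exact: commrD.
- exact: commrM.
- by rewrite /GRing.comm -scalerAl -scalerAr Ha.
- exact: gX.
- exact: gY.
Qed.

Lemma subalg_set0 z : subalg set0 set0 z -> exists k : K, z = k%:A.
Proof.
elim=> [|a b _ [k ->] _ [l ->]|a b _ [k ->] _ [l ->]|k a _ [l ->]|i|i].
- by exists 1; rewrite scale1r.
- by exists (k + l); rewrite scalerDl.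
- by exists (k * l); rewrite -scalerAl mul1r scalerA.
- by exists (k * l); rewrite scalerA.
- by rewrite inE.
- by rewrite inE.
Qed.

Lemma xmonS (I J : {set 'I_n}) m : I \subset J -> xmon I m -> xmon J m.
Proof.
move=> sIJ; elim=> [|i m' iI _ IH]; first exact: xmon1.
by apply: xmonX => //; apply: (subsetP sIJ).
Qed.

Lemma xmonM I a b : xmon I a -> xmon I b -> xmon I (a * b).
Proof. by elim=> [|i m iI _ IH] Hb; rewrite ?mul1r // -mulrA; apply: xmonX; auto. Qed.

Lemma xmon_comm (I : {set 'I_n}) g m :
  (forall j, j \in I -> GRing.comm g (x j)) -> xmon I m -> GRing.comm g m.
Proof.
move=> gI; elim=> [|i m' iI _ IH]; first exact: commr1.
by apply: commrM => //; apply: gI.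
Qed.

Lemma xmon_exp (I : {set 'I_n}) i k : i \in I -> xmon I (x i ^+ k).
Proof.
by move=> iI; elim: k => [|k IH]; [apply: xmon1|rewrite exprS; apply: xmonX].
Qed.

(** * Relations between generators, and the Ore condition *)

Hypothesis yx1 : forall i, y i * x i = 1.
Hypothesis xxC : forall i j, GRing.comm (x i) (x j).
Hypothesis yyC : forall i j, GRing.comm (y i) (y j).
Hypothesis xyC : forall i j, i != j -> GRing.comm (x i) (y j).
Hypothesis genT : forall z, subalg setT setT z.
Implicit Types (I J S : {set 'I_n}).

Lemma yxC i j : i != j -> GRing.comm (y i) (x j).
Proof. by move=> ij; apply/commr_sym/xyC; rewrite eq_sym. Qed.

Lemma yNxN i k : y i ^+ k * x i ^+ k = 1.
Proof.
elim: k => [|k IH]; first by rewrite mulr1.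
by rewrite exprSr exprS mulrA -(mulrA _ (y i)) yx1 mulr1.
Qed.

Lemma ye i : y i * e i = 0.
Proof. by rewrite mulrBr mulr1 mulrA yx1 mul1r subrr. Qed.
Lemma ex i : e i * x i = 0.
Proof. by rewrite mulrBl mul1r -mulrA yx1 mulr1 subrr. Qed.
Lemma ee i : e i * e i = e i.
Proof. by rewrite {1}/e mulrBl mul1r -mulrA ye mulr0 subr0. Qed.

Lemma exC i j : i != j -> GRing.comm (e i) (x j).
Proof.
move=> ij; apply/commr_sym/commrB; first exact: commr1.
by apply: commrM => //; apply: xyC; rewrite eq_sym.
Qed.
Lemma eyC i j : i != j -> GRing.comm (e i) (y j).
Proof.
move=> ij; apply/commr_sym/commrB; first exact: commr1.
by apply: commrM => //; apply: yxC; rewrite eq_sym.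
Qed.

Lemma xmonC I J a b : xmon I a -> xmon J b -> GRing.comm a b.
Proof.
by move=> Ha; apply: xmon_comm => j _; apply/commr_sym/(xmon_comm _ Ha).
Qed.

Lemma xmon_linv I m : xmon I m -> exists v, v * m = 1.
Proof.
elim=> [|i m' _ _ [v vm]]; first by exists 1; rewrite mulr1.
by exists (v * y i); rewrite mulrA -(mulrA v) yx1 mulr1.
Qed.

Lemma xmon_split I i m : xmon (i |: I) m ->
  exists k m', xmon I m' /\ m = x i ^+ k * m'.
Proof.
elim=> [|j m' jI _ [k [m'' [Hm ->]]]].
  by exists 0%N, 1; split; [apply: xmon1|rewrite mulr1].
move: jI; rewrite in_setU1 => /orP[/eqP->|jI].
  by exists k.+1, m''; rewrite exprS mulrA.
exists k, (x j * m''); split; first exact: xmonX.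
by rewrite !mulrA (commrX k (xxC j i)).
Qed.

Lemma subalg_xmonC I w m : subalg setT (~: I) w -> xmon I m -> w * m = m * w.
Proof.
move=> Hw Hm; symmetry; apply: (subalg_comm _ _ Hw) => j Hj.
  by apply/commr_sym/(xmon_comm _ Hm).
apply/commr_sym/(xmon_comm _ Hm) => k kI; apply: yxC.
by apply: contraTneq kI => <-; rewrite -in_setC.
Qed.

(* Ore condition for the monoid generated by the [x i], [i] in [I]. *)
Lemma ore I c : exists2 m, xmon I m & subalg setT (~: I) (c * m).
Proof.
elim: (genT c) => {c} [|a b _ [m Hm Ha] _ [l Hl Hb]
  |a b _ [m Hm Ha] _ [l Hl Hb]|k a _ [m Hm Ha]|i _|i _].
- by exists 1; [apply: xmon1|rewrite mulr1; apply: subalg1].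
- have xW c : xmon I c -> subalg setT (~: I) c.
    elim=> [|i m' _ _ IH]; first exact: subalg1.
    by apply: subalgM => //; apply: subalgX; rewrite inE.
  exists (m * l); first exact: xmonM.
  rewrite mulrDl {2}(xmonC Hm Hl) !mulrA.
  by apply: subalgD; apply: subalgM; auto.
(* Since [b l] no longer involves the [y i] with [i] in [I], it commutes with [m], and
   [a b l m = (a m) (b l)]. *)
- exists (l * m); first exact: xmonM.
  rewrite mulrA -(mulrA a) -mulrA (subalg_xmonC Hb Hm) mulrA.
  exact: subalgM.
- by exists m => //; rewrite -scalerAl; apply: subalgZ.
- by exists 1; [apply: xmon1|rewrite mulr1; apply: subalgX; rewrite inE].
- case: (boolP (i \in I)) => iI.
    exists (x i * 1); first by apply: xmonX => //; apply: xmon1.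
    by rewrite mulr1 yx1; apply: subalg1.
  by exists 1; [apply: xmon1|rewrite mulr1; apply: subalgY; rewrite inE].
Qed.

(** * Saturations and the ideals [pI I] *)

Lemma ideal_opp (a : A -> Prop) z : is_ideal a -> a z -> a (- z).
Proof. by case=> _ _ Hl _ az; rewrite -mulN1r; apply: Hl. Qed.

(** Closure under right multiplication rests on the Ore condition: if [r l] commutes with [m], then
    [u r l m = (u m) (r l)]. *)
Lemma sat_ideal a I : is_ideal a -> is_ideal (sat a I).
Proof.
move=> aI; have [a0 aD al ar] := aI; split.
- by exists 1; [apply: xmon1|rewrite mul0r].
- move=> u v [m Hm um] [l Hl vl]; exists (m * l); first exact: xmonM.
  by rewrite mulrDl {2}(xmonC Hm Hl) !mulrA; apply: aD; apply: ar.
- by move=> r u [m Hm um]; exists m => //; rewrite -mulrA; apply: al.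
move=> r u [m Hm um]; have [l Hl rl] := ore I r.
exists (l * m); first exact: xmonM.
by rewrite mulrA -(mulrA u) -mulrA (subalg_xmonC rl Hm) mulrA; apply: ar.
Qed.

Lemma ideal_zero : is_ideal (eq^~ (0 : A)).
Proof.
by split=> // [a b -> ->|r a ->|r a ->]; rewrite ?addr0 ?mulr0 ?mul0r.
Qed.

Lemma pI_ideal I : is_ideal (pI I).
Proof. exact/sat_ideal/ideal_zero. Qed.

Lemma pIS I J : I \subset J -> subI (pI I) (pI J).
Proof. by move=> sIJ z [m Hm zm]; exists m => //; apply: xmonS Hm. Qed.

(** If [z m = 0] and [v m = 1], then [E = 1 - m v] satisfies [E m = 0] and [z E = z]. *)
Lemma pI_unit I z : pI I z -> exists2 E, pI I E & z = z * E.
Proof.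
move=> [m Hm zm]; have [v vm] := xmon_linv Hm.
exists (1 - m * v); last by rewrite mulrBr mulr1 mulrA zm mul0r subr0.
by exists m => //; rewrite mulrBl mul1r -mulrA vm mulr1 subrr.
Qed.

Lemma e_pI I i : i \in I -> pI I (e i).
Proof.
move=> iI; exists (x i * 1); first by apply: xmonX => //; apply: xmon1.
by rewrite mulr1 ex.
Qed.

(** Here [0 = g m = m g], and [m] has a left inverse. This is the test used below to show that
    elements are not in [pI I]. *)
Lemma pI_comm I g : (forall j, j \in I -> GRing.comm g (x j)) -> pI I g -> g = 0.
Proof.
move=> gI [m Hm gm]; have [v vm] := xmon_linv Hm.
have C : GRing.comm g m by apply: xmon_comm Hm.
by rewrite -(mul1r g) -vm -mulrA -C gm mulr0.
Qed.

Lemma pI_proper I : ~ pI I 1.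
Proof.
move=> H; have /eqP : (1 : A) = 0.
  by apply: pI_comm H => j _; apply/commr_sym/commr1.
by rewrite oner_eq0.
Qed.

(** * Normal forms in one pair of generators *)

Lemma decompose_right (X Y : {set 'I_n}) i z : i \in X -> subalg X Y z ->
  exists2 p : {poly A}, (forall k, subalg X (Y :\ i) p`_k) & z = p.[y i].
Proof.
move=> iX Hz.
pose D u := exists2 p : {poly A}, (forall k, subalg X (Y :\ i) p`_k) & u = p.[y i].
have D0 c : subalg X (Y :\ i) c -> D c.
  move=> Hc; exists c%:P; last by rewrite hornerC.
  by move=> k; rewrite coefC; case: eqP => // _; apply: subalg0.
have DD u v : D u -> D v -> D (u + v).
  move=> [p Hp ->] [q Hq ->]; exists (p + q); last by rewrite hornerD.
  by move=> k; rewrite coefD; apply: subalgD.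
have DC c u : GRing.comm c (y i) -> subalg X (Y :\ i) c -> D u -> D (u * c).
  move=> cC Hc [p Hp ->].
  exists (p * c%:P); first by move=> k; rewrite coefMC; apply: subalgM.
  by rewrite hornerM_comm ?hornerC // /comm_poly hornerC; exact: commr_sym.
(* It is enough that these expressions are stable under right multiplication by the generators. *)
suff DM u : D u -> D (u * z) by rewrite -(mul1r z); apply/DM/D0/subalg1.
elim: Hz u => {z} [|a b _ Ha _ Hb|a b _ Ha _ Hb|k a _ Ha|j jX|j jY] u Du.
- by rewrite mulr1.
- by rewrite mulrDr; apply: DD; auto.
- by rewrite mulrA; auto.
- rewrite -scalerAr; have [p Hp ->] := Ha u Du.
  have -> : k *: p.[y i] = k%:A * p.[y i] by rewrite -scalerAl mul1r.
  exists (k%:A%:P * p); last by rewrite hornerCM.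
  by move=> l; rewrite coefCM; apply: subalgM => //; apply/subalgZ/subalg1.
- have [ij|ij] := eqVneq i j; last first.
    by apply: DC => //; [apply: xyC; rewrite eq_sym|apply: subalgX].
  case: Du => p; rewrite -ij; elim/poly_ind: p => [|p c _] Hp ->.
    by rewrite horner0 mul0r; apply/D0/subalg0.
  (* Multiplying by [x i] lowers the degree in [y i] by one; the constant term becomes [c * x i],
     still an admissible coefficient because [i] is in [X]. *)
  rewrite hornerD hornerC hornerMX mulrDl -mulrA yx1 mulr1; apply: DD.
    exists p => // k; have := Hp k.+1.
    by rewrite coefD coefMX coefC /= addr0.
  apply/D0/subalgM; last exact: subalgX.
  by have := Hp 0%N; rewrite coefD coefMX coefC /= add0r.
have [ij|ij] := eqVneq i j.
  case: Du => p Hp ->; exists (p * 'X); last by rewrite hornerMX ij.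
  by move=> [|k]; rewrite coefMX //=; apply: subalg0.
apply: DC => //.
by apply: subalgY; rewrite !inE eq_sym ij.
Qed.

(** In the absence of [y i], the element [x i] commutes with the whole subalgebra, so evaluation at
    [x i] is multiplicative. *)
Lemma decompose_left (X Y : {set 'I_n}) i z : i \notin Y -> subalg X Y z ->
  exists2 p : {poly A}, (forall k, subalg (X :\ i) Y p`_k) & z = p.[x i].
Proof.
move=> iY; elim=> {z} [|a b _ [p Hp ->] _ [q Hq ->]|a b _ [p Hp ->] _ [q Hq ->]
  |c a _ [p Hp ->]|j jX|j jY].
- exists 1; last by rewrite hornerC.
  by move=> k; rewrite coef1; case: eqP => _; [apply: subalg1|apply: subalg0].
- exists (p + q); last by rewrite hornerD.
  by move=> k; rewrite coefD; apply: subalgD.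
- exists (p * q).
    move=> k; rewrite coefM; elim/big_ind: _ => [|u v|l _]; first exact: subalg0.
      exact: subalgD.
    exact: subalgM.
  rewrite hornerM_comm //; apply: comm_coef_poly => k.
  apply/commr_sym/(subalg_comm _ _ (Hq k)) => j //.
  by move=> jY; apply: xyC; apply: contraNneq iY => ->.
- have -> : c *: p.[x i] = c%:A * p.[x i] by rewrite -scalerAl mul1r.
  exists (c%:A%:P * p); last by rewrite hornerCM.
  by move=> l; rewrite coefCM; apply: subalgM => //; apply/subalgZ/subalg1.
- have [->|ij] := eqVneq j i.
    exists 'X; last by rewrite hornerX.
    by move=> k; rewrite coefX; case: eqP => _; [apply: subalg1|apply: subalg0].
  exists (x j)%:P; last by rewrite hornerC.
  move=> k; rewrite coefC; case: eqP => _; last exact: subalg0.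
  by apply: subalgX; rewrite !inE ij.
exists (y j)%:P; last by rewrite hornerC.
by move=> k; rewrite coefC; case: eqP => _; [apply: subalgY|apply: subalg0].
Qed.

(** * Representations on sequences, and closure of idempotent ideals *)

Hypothesis universal : forall (B : algType K) (x' y' : 'I_n -> B),
  jac_rel x' y' -> exists f : A -> B, alg_morph f /\
    forall i, f (x i) = x' i /\ f (y i) = y' i.

Lemma lmulE_comm (a b : A) : GRing.comm a b -> GRing.comm (lmulE a) (lmulE b).
Proof. by move=> ab; apply: seqEndP => u k; rewrite !seqfun_mul /= !mulrA ab. Qed.

(** Only the pair of index [i] is replaced; the other generators keep acting by left multiplication,
    so the relations reduce to [Y X = 1] and to commutation with these multiplications. *)
Lemma seq_rep i (X Y : seqEnd A) : Y * X = 1 ->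
  (forall a, GRing.comm a (x i) -> GRing.comm a (y i) ->
     GRing.comm X (lmulE a) /\ GRing.comm Y (lmulE a)) ->
  exists f : A -> seqEnd A, [/\ alg_morph f, f (x i) = X, f (y i) = Y &
    forall w, subalg [set~ i] [set~ i] w -> f w = lmulE w].
Proof.
move=> YX XYC.
pose X' j := if j == i then X else lmulE (x j).
pose Y' j := if j == i then Y else lmulE (y j).
have Cx j : j != i -> GRing.comm X (lmulE (x j)) /\ GRing.comm Y (lmulE (x j)).
  by move=> ji; apply: XYC => //; apply: xyC.
have Cy j : j != i -> GRing.comm X (lmulE (y j)) /\ GRing.comm Y (lmulE (y j)).
  by move=> ji; apply: XYC => //; apply: yxC.
have [|f [fM fxy]] := @universal _ X' Y'.
  split=> [j|j k jk]; rewrite /X' /Y'.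
    case: eqP => // _; apply: seqEndP => u k.
    by rewrite seqfun_mul /= mulrA yx1 mul1r.
  have [ji|ji] := eqVneq j i.
    have ki : k != i by rewrite -ji eq_sym.
    rewrite (negbTE ki); have [? ?] := Cx k ki; have [? ?] := Cy k ki.
    by split.
  have [ki|ki] := eqVneq k i.
    have [? ?] := Cx j ji; have [? ?] := Cy j ji.
    by split; apply: commr_sym.
  by split; apply: lmulE_comm => //; apply: xyC.
have [f1 fD fMM fZ] := fM.
exists f; split=> //.
- by have [-> _] := fxy i; rewrite /X' eqxx.
- by have [_ ->] := fxy i; rewrite /Y' eqxx.
move=> w; elim=> {w} [|a b _ Ha _ Hb|a b _ Ha _ Hb|k a _ Ha|j|j].
- by rewrite f1; apply: seqEndP => u k /=; rewrite mul1r.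
- by rewrite fD Ha Hb; apply: seqEndP => u k; rewrite seqfun_add /= mulrDl.
- by rewrite fMM Ha Hb; apply: seqEndP => u k; rewrite seqfun_mul /= mulrA.
- by rewrite fZ Ha; apply: seqEndP => u l; rewrite seqfun_scale /= scalerAl.
- by rewrite !inE => ji; have [-> _] := fxy j; rewrite /X' (negbTE ji).
- by rewrite !inE => ji; have [_ ->] := fxy j; rewrite /Y' (negbTE ji).
Qed.

(** The power series [1], on which operators are evaluated to read off coefficients. *)
Definition delta (k : nat) : A := if k == 0%N then 1 else 0.

Definition eprod I (s : seq 'I_n) : A := \prod_(i <- s | i \notin I) e i.

Lemma e_subalg S i : i \in S -> subalg S S (e i).
Proof.
move=> iS; rewrite /e -scaleN1r; apply: subalgD; first exact: subalg1.
by apply: subalgZ; apply: subalgM; [apply: subalgX|apply: subalgY].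
Qed.

Lemma eprod_subalg I S s : {subset s <= S} -> subalg S S (eprod I s).
Proof.
move=> sS; rewrite /eprod big_seq_cond; elim/big_rec: _ => [|i z /andP[/sS iS _] Hz].
  exact: subalg1.
by apply: subalgM => //; apply: e_subalg.
Qed.

(** Let [x i] and [y i] act by shift and unshift. Then [e i] preserves the term of index [0], while
    the remaining factors act by left multiplication; so if the product vanishes, evaluation on
    [delta] shows that the product of the remaining factors vanishes. *)
Lemma eprod_neq0 I s : uniq s -> eprod I s != 0.
Proof.
elim: s => [|i s IH] /=; first by rewrite /eprod big_nil oner_neq0.
move=> /andP[i_s /IH]; rewrite /eprod big_cons; case: ifP => // _.
apply: contra => /eqP H.
have [||f [[f1 fD fM fZ] fx fy fw]] := @seq_rep i (shiftE A) (unshiftE A).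
- exact: seqEndP.
- by move=> a _ _; split; apply: seqEndP => u [|k] //=; rewrite ?mulr0.
have f0 : f 0 = 0 by rewrite -(scale0r 1) fZ scale0r.
have fe u : f (e i) u 0%N = u 0%N.
  rewrite /e -scaleN1r fD f1 fZ fM fx fy seqfun_add seqfun_scale seqfun_mul /=.
  by rewrite scaler0 addr0.
have := congr1 (fun z => f z delta 0%N) H; rewrite /= fM f0 seqfun_mul fe fw.
  by rewrite /= mulr1 => ->.
by apply: eprod_subalg => j js; rewrite !inE; apply: contraNneq i_s => <-.
Qed.

(** Strong induction on [k], with [z] a sum of products [a b] of elements of [J]. The terms of
    [f b u] before [k] lie in [J], so modulo [J] the term of index [k] of [f a (f b u)] is [a] times
    that of [f b u], which lies in [J] because [a] does. *)
Lemma idem_seq_rep_closed (J : A -> Prop) i (f : A -> seqEnd A) :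
  idempotent_ideal J -> alg_morph f ->
  f (x i) = lmulE (x i) + shiftE A -> f (y i) = geomE (y i) ->
  (forall w, subalg [set~ i] [set~ i] w -> f w = lmulE w) ->
  forall z u k, J z -> J (f z u k).
Proof.
move=> [JI JJ] [f1 fD fM fZ] fx fy fw; have [J0 JD Jl Jr] := JI.
have JN a b : J a -> J b -> J (a - b) by move=> Ja Jb; apply: JD => //; apply: ideal_opp.
(* On the first term of [u] outside [J], [f a] is left multiplication by [a] modulo [J]. *)
have lead a m (u : nat -> A) : (forall k, (k < m)%N -> J (u k)) ->
    (forall k, (k < m)%N -> J (f a u k)) /\ J (f a u m - a * u m).
  elim: (genT a) m u => {a} [|a b _ Ha _ Hb|a b _ Ha _ Hb|c a _ Ha|j _|j _] m u Hu.
  - by rewrite f1 seqfun_one mul1r subrr.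
  - have [? ?] := Ha m u Hu; have [? ?] := Hb m u Hu; rewrite fD; split=> [k km|].
      by apply: JD; auto.
    by rewrite seqfun_add mulrDl opprD addrACA; apply: JD.
  - have [Hb1 Hb2] := Hb m u Hu; rewrite fM seqfun_mul.
    have [Ha1 Ha2] := Ha m _ Hb1; split=> //.
    by have := JD _ _ Ha2 (Jl a _ Hb2); rewrite mulrBr addrA subrK mulrA.
  - have [Ha1 Ha2] := Ha m u Hu; rewrite fZ; split=> [k km|].
      by rewrite seqfun_scale -mulr_algl; apply: Jl; auto.
    by rewrite seqfun_scale -scalerAl -scalerBr -mulr_algl; apply: Jl.
  - have [->|ji] := eqVneq j i; last first.
      rewrite fw ?subrr; last by apply: subalgX; rewrite !inE.
      by split=> // k km; apply: Jl; apply: Hu.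
    rewrite fx; split=> [[|k] km|].
    + by rewrite seqfun_add /= addr0; apply: Jl; apply: Hu.
    + by rewrite seqfun_add /=; apply: JD; [apply: Jl|]; apply: Hu => //; apply: ltnW.
    + rewrite seqfun_add /= addrC addKr.
      by case: m Hu => [|m] Hu //; apply: Hu.
  have [->|ji] := eqVneq j i; last first.
    rewrite fw ?subrr; last by apply: subalgY; rewrite !inE.
    by split=> // k km; apply: Jl; apply: Hu.
  rewrite fy /=.
  have H k : (k < m)%N -> J (geom (y i) u k).
    elim: k => [|k IH] km /=; first by apply: Jl; apply: Hu.
    by apply: JN; apply: Jl; [apply: Hu|apply: IH; apply: ltnW].
  split=> //; case: m Hu H => [|m] Hu H /=; first by rewrite subrr.
  by rewrite addrC addKr; apply: ideal_opp => //; apply: Jl; apply: H.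
move=> z u k; elim/ltn_ind: k z u => k IH z u /JJ[m [a [b [Hab ->]]]].
have f0 : f 0 = 0 by rewrite -(scale0r 1) fZ scale0r.
have fSE (r : seq 'I_m) (F : 'I_m -> seqEnd A) :
    (\sum_(l <- r) F l) u k = \sum_(l <- r) F l u k.
  exact: (big_morph (fun g : seqEnd A => g u k)).
rewrite (big_morph f fD f0) fSE; apply: big_ind => // l _; rewrite fM seqfun_mul.
have [Ja Jb] := Hab l.
have [|_ H] := lead (a l) k (f (b l) u); first by move=> j jk; apply: IH.
by have := JD _ _ H (Jr (f (b l) u k) _ Ja); rewrite subrK.
Qed.

(** The map [f] substitutes [x i + s] for [x i], and the coefficient of [s ^ d] in [p.[x i + s]] is
    the top coefficient of [p]; it is the term of index [d] of [f p.[x i] delta]. *)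
Lemma idem_top_coef (J : A -> Prop) i (p : {poly A}) d : idempotent_ideal J ->
  (forall k, subalg [set~ i] [set~ i] p`_k) -> (forall k, (d < k)%N -> p`_k = 0) ->
  J p.[x i] -> J p`_d.
Proof.
move=> idJ Hp pd Jp.
have [||f [fM fx fy fw]] := @seq_rep i (lmulE (x i) + shiftE A) (geomE (y i)).
- apply: seqEndP => u; elim=> [|k IH]; rewrite seqfun_mul seqfun_one.
    by rewrite geomE0 lmul_shiftE addr0 mulrA yx1 mul1r.
  rewrite seqfun_mul seqfun_one in IH.
  by rewrite geomES IH lmul_shiftE mulrDr mulrA yx1 mul1r addrK.
- move=> a ax ay; split; apply: seqEndP => u k; rewrite !seqfun_mul.
    rewrite lmul_shiftE !lmulEE lmul_shiftE mulrDr !mulrA ax; congr (_ + _).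
    by case: k => //; rewrite mulr0.
  elim: k => [|k IH]; first by rewrite lmulEE !geomE0 !lmulEE !mulrA ay.
  by rewrite geomES IH !lmulEE geomES mulrBr !mulrA ay.
have cl := idem_seq_rep_closed idJ fM fx fy fw.
have [f1 fD fMM fZ] := fM.
have f0 : f 0 = 0 by rewrite -(scale0r 1) fZ scale0r.
suff <- : f p.[x i] delta d = p`_d by apply: cl.
elim/poly_ind: p d Hp pd {Jp} => [|p c IH] d Hp pd.
  by rewrite horner0 coef0 f0.
have pE k : p`_k = (p * 'X + c%:P)`_k.+1 by rewrite coefD coefMX coefC /= addr0.
have cE : c = (p * 'X + c%:P)`_0 by rewrite coefD coefMX coefC /= add0r.
have Hp' k : subalg [set~ i] [set~ i] p`_k by rewrite pE.
have px : GRing.comm p.[x i] (x i).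
  apply/commr_sym/comm_coef_poly => k.
  apply/commr_sym/(subalg_comm _ _ (Hp' k)) => // j.
  by rewrite !inE eq_sym => ij; apply: xyC.
(* The quotient [p] has degree below [d], so these terms vanish. In index [d] there remains only the
   shifted term of index [d - 1], or [c] when [d] is [0]. *)
have fp m : (d <= m)%N -> f p.[x i] delta m = p`_m.
  move=> dm; apply: IH => // k mk; rewrite pE pd //.
  by apply: leq_ltn_trans dm _; apply: ltnW.
rewrite hornerD hornerMX hornerC px fD fMM fx seqfun_add seqfun_mul lmul_shiftE.
rewrite (fw c); last by rewrite cE.
rewrite fp // pE pd // mulr0 add0r coefD coefMX coefC /=.
case: d pd fp => [|d] pd fp /=; rewrite /delta /= ?mulr1 ?mulr0 // addr0.
by rewrite addr0 IH // => k dk; rewrite pE pd.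
Qed.

(** * Corners and leading coefficients *)

Lemma yxe i j k : (j < k)%N -> y i ^+ k * x i ^+ j * e i = 0.
Proof.
move=> jk; rewrite -(subnK (ltnW jk)) exprD -(mulrA (y i ^+ (k - j))) yNxN mulr1.
by move: jk; rewrite -subn_gt0; case: (k - j)%N => // d _; rewrite exprSr -mulrA ye mulr0.
Qed.

(** Expand [c] in powers of [y i], and let [l] be the least exponent with nonzero coefficient:
    multiplying on the right by [x i ^+ l * e i] leaves that coefficient times [e i]. If it has
    degree [k] in [x i], multiplying on the left by [e i * y i ^+ k] isolates its leading
    coefficient [b]. *)
Lemma corner S (Y : {set 'I_n}) i c : i \in S -> subalg S Y c -> c != 0 ->
  exists b k l, [/\ subalg (S :\ i) (Y :\ i) b, b != 0 &
    e i * y i ^+ k * c * x i ^+ l * e i = b * e i].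
Proof.
move=> iS Hc c0; have [p Hp cE] := decompose_right iS Hc.
have [l pl lmin] : exists2 l, p`_l != 0 & forall j, (j < l)%N -> p`_j = 0.
  have ex_l : exists l, p`_l != 0.
    exists (size p).-1; rewrite -lead_coefE lead_coef_eq0.
    by apply: contra_neq c0 => p0; rewrite cE p0 horner0.
  case: (ex_minnP ex_l) => l pl lmin; exists l => // j jl.
  by apply/eqP; apply: contraTT jl => /lmin; rewrite -leqNgt.
have [q Hq plE] := decompose_left (negbT (setD11 i Y)) (Hp l).
have q0 : lead_coef q != 0.
  by rewrite lead_coef_eq0; apply: contra_neq pl => q0; rewrite plE q0 horner0.
have cxe : c * x i ^+ l * e i = p`_l * e i.
  rewrite cE horner_coef !mulr_suml.
  have lp : (l < size p)%N.
    by rewrite ltnNge; apply: contra pl => ?; rewrite nth_default.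
  rewrite (bigD1 (Ordinal lp)) //= big1 ?addr0 => [|j jl].
    by rewrite -(mulrA p`_l) yNxN mulr1.
  have [jl'|jl'] := ltnP j l; first by rewrite lmin // !mul0r.
  rewrite -(mulrA p`_j) -mulrA yxe ?mulr0 // ltn_neqAle jl' andbT eq_sym.
  by rewrite -val_eqE in jl.
exists (lead_coef q), (size q).-1, l; split=> //; first exact: Hq.
have -> : e i * y i ^+ (size q).-1 * c * x i ^+ l * e i =
    e i * (y i ^+ (size q).-1 * (c * x i ^+ l * e i)) by rewrite !mulrA.
rewrite cxe plE horner_coef mulr_suml.
have sq : ((size q).-1 < size q)%N by rewrite prednK // size_poly_gt0 -lead_coef_eq0.
have qe k : GRing.comm (e i) q`_k.
  apply: subalg_comm (Hq k) => j; rewrite !inE => /andP[ji _].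
    by apply: exC; rewrite eq_sym.
  by apply: eyC; rewrite eq_sym.
have qy k : GRing.comm (y i ^+ (size q).-1) q`_k.
  apply/commr_sym/commrX/commr_sym; apply: subalg_comm (Hq k) => j.
    by rewrite !inE => /andP[ji _]; apply: yxC; rewrite eq_sym.
  by move=> _; apply: yyC.
have term k : e i * (y i ^+ (size q).-1 * (q`_k * x i ^+ k * e i)) =
    q`_k * (e i * (y i ^+ (size q).-1 * x i ^+ k * e i)).
  by rewrite -mulrA (mulrA _ q`_k) qy !mulrA qe.
rewrite !mulr_sumr (bigD1 (Ordinal sq)) //= term yNxN mul1r ee lead_coefE.
rewrite big1 ?addr0 // => k kq; rewrite term yxe ?mulr0 //.
by rewrite ltn_neqAle -ltnS prednK ?ltn_ord ?andbT // size_poly_gt0 -lead_coef_eq0.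
Qed.

(** Stated with degree bounds, since the coefficient ring may have zero divisors and the product of
    two leading coefficients may vanish. *)
Lemma coef_top_mul (p q : {poly A}) d l :
  (forall k, (d < k)%N -> p`_k = 0) -> (forall k, (l < k)%N -> q`_k = 0) ->
  (p * q)`_(d + l) = p`_d * q`_l /\ forall k, (d + l < k)%N -> (p * q)`_k = 0.
Proof.
move=> Hp Hq; split=> [|k dlk]; rewrite coefM.
  have dl : (d < (d + l).+1)%N by rewrite ltnS leq_addr.
  rewrite (bigD1 (Ordinal dl)) //= addKn big1 ?addr0 // => j jd.
  have [dj|jd'] := ltnP d j; first by rewrite Hp // mul0r.
  rewrite Hq ?mulr0 // ltn_subRL ltn_add2r ltn_neqAle jd' andbT.
  by rewrite -val_eqE in jd.
apply: big1 => j _; have [dj|jd] := ltnP d j; first by rewrite Hp // mul0r.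
by rewrite Hq ?mulr0 // ltn_subRL; apply: leq_ltn_trans dlk; rewrite leq_add2r.
Qed.

Lemma set_cons i (s : seq 'I_n) : i \notin s ->
  [set j in i :: s] :\ i = [set j in s].
Proof.
move=> i_s; apply/setP => j; rewrite !inE; have [->|//] := eqVneq j i.
by rewrite (negbTE i_s).
Qed.

(** The indices of [s] are eliminated one by one: [g] collects the factors [e i] already produced,
    and [c], [c'] involve only the remaining indices. For [i] outside [I] both are cut by corners;
    for [i] in [I] they do not involve [y i], and leading coefficients in [x i] are taken. Nonzero
    scalars remain at the end. *)
Lemma eprod_mem_rec I (J : A -> Prop) (s : seq 'I_n) g c c' : idempotent_ideal J -> uniq s ->
  let S := [set j in s] in
  subalg (~: S) (~: S) g -> subalg S (S :\: I) c -> subalg S (S :\: I) c' ->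
  c != 0 -> c' != 0 -> (forall r, subalg S S r -> J (g * c * r * c')) ->
  J (g * eprod I s).
Proof.
move=> idJ; have [[J0 JD Jl Jr] _] := idJ.
elim: s g c c' => [|i s IH] g c c' /=.
  have -> : [set j in [::]] = set0 :> {set 'I_n} by apply/setP => j; rewrite !inE.
  rewrite set0D => _ _ /subalg_set0[k ->] /subalg_set0[l ->] k0 l0 HJ.
  have nz (m : K) : m%:A != 0 :> A -> m != 0.
    by apply: contra_neq => ->; rewrite scale0r.
  have Jg : J (l *: (k *: g)).
    by have := HJ 1 (subalg1 _ _); rewrite mulr1 -scalerAr -scalerAr !mulr1.
  rewrite /eprod big_nil mulr1.
  have -> : g = (k^-1 / l)%:A * (l *: (k *: g)).
    by rewrite mulr_algl !scalerA mulrA divfK ?nz // mulVf ?nz // scale1r.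
  exact: Jl.
move=> /andP[i_s us].
set S := [set j in i :: s]; set S' := [set j in s] in IH *.
have SE : S :\ i = S' by apply: set_cons.
have iS : i \in S by rewrite !inE eqxx.
have S'S : S' \subset S by rewrite -SE subsetDl.
have iS' : i \notin S' by rewrite inE.
move=> Hg Hc Hc' c0 c'0 HJ.
have gx : GRing.comm g (x i).
  apply/commr_sym/(subalg_comm _ _ Hg) => j; rewrite inE => jS //.
  by apply: xyC; apply: contraNneq jS => <-.
have gy : GRing.comm g (y i).
  apply/commr_sym/(subalg_comm _ _ Hg) => j; rewrite inE => jS //.
  by apply: yxC; apply: contraNneq jS => <-.
have Hg' : subalg (~: S') (~: S') g by apply: subalgS Hg; rewrite setCS.
have oS' j : j \in S' -> i != j by apply: contraTneq => <-.
rewrite /eprod big_cons; case: ifPn => [iI|/negPn iI]; last first.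
  have iY : i \notin S :\: I by rewrite inE iI.
  have [p Hp cE] := decompose_left iY Hc; have [q Hq c'E] := decompose_left iY Hc'.
  rewrite SE in Hp Hq.
  have YE : S :\: I = S' :\: I.
    by apply/setP => j; rewrite -SE !inE; case: eqVneq => // ->; rewrite iI.
  have p0 : lead_coef p != 0.
    by rewrite lead_coef_eq0; apply: contra_neq c0 => p0; rewrite cE p0 horner0.
  have q0 : lead_coef q != 0.
    by rewrite lead_coef_eq0; apply: contra_neq c'0 => q0; rewrite c'E q0 horner0.
  apply: (IH g (lead_coef p) (lead_coef q)) => //; rewrite -?YE ?lead_coefE //.
  move=> r Hr.
  have xr : GRing.comm (x i) r.
    by apply: subalg_comm Hr => j // /oS'; apply: xyC.
  have xq k : GRing.comm (x i) q`_k.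
    apply: subalg_comm (Hq k) => // j; rewrite YE inE => /andP[_ /oS'].
    exact: xyC.
  have S'i : S' \subset [set~ i].
    by apply/subsetP => j jS; rewrite !inE eq_sym oS'.
  have Hsub w : subalg S' (S' :\: I) w -> subalg [set~ i] [set~ i] w.
    by apply: subalgS => //; apply: subset_trans S'i; apply: subsetDl.
  (* As [x i] commutes with [r] and with the coefficients of [q], the value of [P] at [x i] is
     [g c r c']. *)
  pose P := g%:P * (p * (r%:P * q)).
  have rq k : ((size q).-1 < k)%N -> (r%:P * q)`_k = 0.
    move=> qk; rewrite coefCM nth_default ?mulr0 //.
    by apply: leq_trans qk; apply: leqSpred.
  have pz k : ((size p).-1 < k)%N -> p`_k = 0.
    by move=> pk; rewrite nth_default //; apply: leq_trans pk; apply: leqSpred.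
  have [topE top0] := coef_top_mul pz rq.
  have -> : g * p`_(size p).-1 * r * q`_(size q).-1 = P`_((size p).-1 + (size q).-1).
    by rewrite coefCM topE coefCM !mulrA.
  apply: (idem_top_coef idJ (i := i)) => [k|k dk|].
  - rewrite coefCM; apply: subalgM.
      apply: subalgS Hg; apply/subsetP => j; rewrite !inE;
      by apply: contraNneq => ->; rewrite eqxx.
    rewrite coefM; elim/big_ind: _ => [|u v|l _]; first exact: subalg0.
      exact: subalgD.
    apply: subalgM; first by apply: Hsub; rewrite -YE.
    rewrite coefCM; apply: subalgM; last by apply: Hsub; rewrite -YE.
    exact: subalgS Hr.
  - by rewrite coefCM top0 // mulr0.
  rewrite /P hornerCM hornerM_comm ?hornerCM -?cE -?c'E ?mulrA.
    by apply: HJ; apply: subalgS Hr.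
  rewrite /comm_poly hornerCM; apply: commrM => //.
  exact/comm_coef_poly/(fun k => commr_sym (xq k)).
have SY : (S :\: I) :\ i = S' :\: I by rewrite setDDl setUC -setDDl SE.
have [b [k [l [Hb b0 bE]]]] := corner iS Hc c0.
have [b' [k' [l' [Hb' b'0 b'E]]]] := corner iS Hc' c'0.
rewrite SE SY in Hb Hb'.
rewrite mulrA; apply: (IH (g * e i) b b') => // [|r Hr].
  apply: subalgM => //; apply: subalgS (e_subalg (set11 i)).
    by rewrite sub1set inE.
  by rewrite sub1set inE.
have eC w : subalg S' S' w -> GRing.comm (e i) w.
  by apply: subalg_comm => j /oS' ij; [apply: exC|apply: eyC].
have eb : GRing.comm (e i) b.
  by apply: eC; apply: subalgS Hb => //; apply: subsetDl.
have er := eC r Hr.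
have HS' w : subalg S' S' w -> subalg S S w by apply: subalgS.
have xS : subalg S S (x i) by apply: subalgX.
have yS : subalg S S (y i) by apply: subalgY.
have XS w m : subalg S S w -> subalg S S (w ^+ m).
  by move=> Hw; elim: m => [|m IHm]; [apply: subalg1|rewrite exprS; apply: subalgM].
have eS := e_subalg iS.
(* Placed between [c] and [c'], this element supplies the right half of the corner of [c] and the
   left half of that of [c']. *)
have Hr' : subalg S S (x i ^+ l * e i * r * e i * y i ^+ k').
  by do 4?[apply: subalgM]; auto.
have ge : GRing.comm g (e i).
  by apply: commrB; [apply: commr1|apply: commrM].
have -> : g * e i * b * r * b' =
    e i * y i ^+ k * (g * c * (x i ^+ l * e i * r * e i * y i ^+ k') * c') *
    (x i ^+ l' * e i).
  have gyk : GRing.comm g (e i * y i ^+ k) by apply: commrM => //; apply: commrX.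
  transitivity (g * (b * e i) * r * (b' * e i)); last first.
    by rewrite -bE -b'E !mulrA -gyk !mulrA.
  have eb' : GRing.comm (e i) b'.
    by apply: eC; apply: subalgS Hb' => //; apply: subsetDl.
  have -> : g * (b * e i) * r * (b' * e i) = g * b * (e i * r * e i) * b'.
    by rewrite -eb' !mulrA.
  by rewrite -(mulrA (e i) r) -er (mulrA (e i)) ee -(mulrA g) eb !mulrA.
by apply: Jr; apply: Jl; apply: HJ.
Qed.

(** * Primeness and inclusions of the ideals [pI I] *)

Definition eprodC I : A := eprod I (enum 'I_n).

(* For [J = pI I] this is the primeness of [pI I]; for [c' = 1] it produces
   elements of an idempotent ideal. *)
Lemma eprodC_mem I (J : A -> Prop) c c' : idempotent_ideal J -> ~ pI I c -> ~ pI I c' ->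
  (forall r, J (c * r * c')) -> J (eprodC I).
Proof.
move=> idJ Hc Hc' HJ; have [[_ _ _ Jr] _] := idJ.
(* The products [c m] and [c' l] are free of the [y i] with [i] in [I], and nonzero because [c] and
   [c'] are not in [pI I]. *)
have [m Hm cm] := ore I c; have [l Hl c'l] := ore I c'.
have ST : [set j in enum 'I_n] = setT by apply/setP => j; rewrite !inE mem_enum.
rewrite /eprodC -[eprod _ _]mul1r; apply: (@eprod_mem_rec _ _ _ _ (c * m) (c' * l)).
- by [].
- exact: enum_uniq.
- exact: subalg1.
- by rewrite ST setTD.
- by rewrite ST setTD.
- by apply/eqP => H; apply: Hc; exists m.
- by apply/eqP => H; apply: Hc'; exists l.
by move=> r _; rewrite mul1r mulrA -(mulrA c); apply: Jr.
Qed.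

Lemma eprodC_notin I : ~ pI I (eprodC I).
Proof.
move/pI_comm => H; apply/negP: (eprod_neq0 I (enum_uniq 'I_n)).
rewrite negbK; apply/eqP/H => j jI.
apply/commr_sym; rewrite /eprodC /eprod; elim/big_rec: _ => [|i z iI IH].
  exact: commr1.
by apply: commrM => //; apply/commr_sym/exC; apply: contraNneq iI => ->.
Qed.

Lemma pI_idem I : idempotent_ideal (pI I).
Proof.
split; first exact: pI_ideal.
have [_ _ Hl _] := pI_ideal I => z; split.
  by apply: mulI_sub => [|a b _]; [apply: pI_ideal|apply: Hl].
by move=> Hz; have [E HE ->] := pI_unit Hz; apply: mulI_mem.
Qed.

Lemma pI_prime I : prime_ideal (pI I).
Proof.
split; first by split; [apply: pI_ideal|move=> /(_ 1)[_ H]; apply: (@pI_proper I); apply: H].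
move=> J L [_ _ _ Jr] _ JL.
have [|/existsNP[c /not_implyP[Jc Hc]]] := pselect (subI J (pI I)); first by left.
have [|/existsNP[c' /not_implyP[Lc' Hc']]] := pselect (subI L (pI I)); first by right.
case: (@eprodC_notin I); apply: eprodC_mem (pI_idem I) Hc Hc' _ => r.
by apply: JL; apply: mulI_mem => //; apply: Jr.
Qed.

(** For [i] in [I] but not in [J], the element [e i] would lie in [pI J] and commute with all [x j],
    [j] in [J], hence vanish. *)
Lemma pI_subset I J : subI (pI I) (pI J) -> I \subset J.
Proof.
move=> sIJ; apply/subsetP => i iI; apply: contraT => iJ.
have /eqP : e i = 0.
  apply: (@pI_comm J); last exact/sIJ/e_pI.
  by move=> j jJ; apply: exC; apply: contraNneq iJ => ->.
have := @eprod_neq0 set0 [:: i] isT.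
by rewrite /eprod big_cons big_nil inE mulr1 => /negbTE->.
Qed.

(** Right units for [z] from the separate factors multiply to a right unit in the product, which
    places the intersection inside the product. *)
Lemma prodI_pI_unit (s : seq {set 'I_n}) z : (forall I, I \in s -> pI I z) ->
  exists2 E, prodI (map pI s) E & z = z * E.
Proof.
elim: s => [|I s IH] Hs; first by exists 1; rewrite ?mulr1.
have [|E HE zE] := IH; first by move=> L Ls; apply: Hs; rewrite inE Ls orbT.
have [F HF zF] := pI_unit (Hs I (mem_head _ _)).
by exists (F * E); [apply: mulI_mem|rewrite mulrA -zF].
Qed.

(** * Descent, separation and decomposition of idempotent ideals *)

Lemma eprod_descent I (b : A -> Prop) z (s : seq 'I_n) g : is_ideal b -> uniq s ->
  (forall i, i \in s -> i \notin I -> sat b [set i] z) ->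
  (forall j, j \in s -> GRing.comm g (x j)) ->
  (forall r, b (z * r * (g * eprod I s))) -> forall r, b (z * r * g).
Proof.
move=> bI; have [b0 bD bl br] := bI.
elim: s g => [|i s IH] g /=; first by rewrite /eprod big_nil mulr1.
move=> /andP[i_s us] Hz gx; rewrite /eprod big_cons.
have Hz' j : j \in s -> j \notin I -> sat b [set j] z.
  by move=> js; apply: Hz; rewrite inE js orbT.
have gx' j : j \in s -> GRing.comm g (x j) by move=> js; apply: gx; rewrite inE js orbT.
case: ifPn => [iI|_ H]; last exact: IH.
rewrite mulrA => H.
have He r : b (z * r * (g * e i)).
  apply: IH => // j js; apply/commr_sym/commrM; first exact/commr_sym/gx'.
  by apply/commr_sym/exC; apply: contraNneq i_s => ->.
(* Here [m] is a power of [x i]; the identity [g = x i * g * y i + g * e i] lowers its exponent down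
   to [0]. *)
have step m r : xmon [set i] m -> b (z * r * m) -> b (z * r * g).
  move=> Hm; elim: Hm r => [|j m' + _ IHm] r; first by rewrite mulr1; apply: br.
  rewrite inE => /eqP-> Hr.
  have /IHm Hxg : b (z * (r * x i) * m') by rewrite -!mulrA in Hr *.
  have -> : z * r * g = z * (r * x i) * g * y i + z * r * (g * e i).
    rewrite /e mulrBr mulr1 mulrBr !mulrA -(mulrA _ g (x i)) gx ?mem_head //.
    by rewrite !mulrA addrC subrK.
  by apply: bD => //; apply: br.
move=> r; have [_ _ _ Hr] := sat_ideal [set i] bI.
by have [m Hm] := Hr r z (Hz i (mem_head _ _) iI); apply: step.
Qed.

(** Take [I] maximal with [z] outside [sat a I]. If [a] were not contained in [pI I], then
    [eprodC I] would lie in [a]; by maximality [z] lies in the further saturation of [sat a I] at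
    each [i] outside [I], and descent puts [z] itself in [sat a I]. *)
Lemma idem_separate (a : A -> Prop) z : idempotent_ideal a -> ~ a z ->
  exists2 I, subI a (pI I) & ~ pI I z.
Proof.
move=> idA az; have [aI _] := idA; have [a0 aD al ar] := aI.
have sat0 : `[< ~ sat a set0 z >].
  apply/asboolP => -[m Hm]; suff -> : m = 1 by rewrite mulr1.
  by elim: Hm => // i m'; rewrite inE.
have [I /maxsetP[/asboolP HI maxI] _] := @maxset_exists _ (fun I => `[< ~ sat a I z >]) _ sat0.
have a_sat u : a u -> sat a I u by exists 1; [apply: xmon1|rewrite mulr1].
(* Since [0] is in [a], the ideal [pI I] is contained in [sat a I]. *)
exists I; last by move=> [m Hm zm]; apply: HI; exists m => //; rewrite zm.
apply: contrapT => /existsNP[c /not_implyP[ac Hc]].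
have eIa : a (eprodC I).
  apply: eprodC_mem idA Hc (@pI_proper I) _ => r; rewrite mulr1; exact: ar.
apply: HI; rewrite -(mulr1 z) -[z * 1]mulr1.
apply: (@eprod_descent I _ _ (enum 'I_n)) => [|||j _|r].
- exact: sat_ideal.
- exact: enum_uniq.
- move=> i _ iI; apply: contrapT => Hi.
  have /maxI : `[< ~ sat a (i |: I) z >].
    apply/asboolP => -[m /xmon_split[k [m' [Hm' ->]]] Hm]; apply: Hi.
    exists (x i ^+ k); first by apply: xmon_exp; rewrite inE.
    by exists m' => //; rewrite -mulrA.
  by move=> /(_ (subsetU1 _ _)) E; rewrite -E setU11 in iI.
- exact/commr_sym/commr1.
by rewrite mul1r; apply: a_sat; apply: al.
Qed.

(** The family is indexed by the minimal [I] with [a] contained in [pI I]. Each [pI I] containing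
    [a] contains one of these, so by separation their intersection is [a]. *)
Lemma idem_decomposition (a : A -> Prop) : idempotent_ideal a ->
  exists s (q : 'I_s -> A -> Prop),
    [/\ good_family q, eqI a (capF q) & subI (capF q) (prodF q)].
Proof.
move=> idA; pose P I := `[< subI a (pI I) >].
pose M := [set I | minset P I].
have MP (k : 'I_#|M|) : minset P (enum_val k) by have := enum_valP k; rewrite inE.
have Mmin (k l : 'I_#|M|) : enum_val k \subset enum_val l -> k = l.
  move=> kl; apply: enum_val_inj.
  by have /minsetP[_ H] := MP l; apply: H => //; apply: minsetp (MP k).
exists #|M|, (fun k => pI (enum_val k)); split.
- split=> [i|i j ij]; first by split; [apply: pI_prime|apply: pI_idem].
  by split=> /pI_subset /Mmin E; rewrite E eqxx in ij.
- move=> z; split=> [az k|Hz].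
    by have /minsetp/asboolP := MP k; apply.
  apply: contrapT => /(idem_separate idA)[I aI]; apply.
  have [B Bmin BI] := minset_exists (introT (asboolP _) aI : P I).
  have BM : B \in M by rewrite inE.
  apply: (pIS BI); rewrite -(enum_rankK_in BM BM); exact: Hz.
move=> z Hz; rewrite /prodF (map_comp pI).
have [I /mapP[k _ ->]|E HE ->] := @prodI_pI_unit [seq enum_val k | k <- enum 'I_#|M|] z.
  exact: Hz.
by have [_ _ Hl _] := prodI_ideal pI_ideal [seq enum_val k | k <- enum 'I_#|M|]; apply: Hl.
Qed.

End OneSidedInverses.

Theorem theorem7p3 (K : fieldType) (n : nat) (A : algType K)
    (x y : 'I_n -> A) (HS : is_Sn x y)
    (a : A -> Prop) (Ha : idempotent_ideal a) (Hne : ~ eqI a (@fullI K A)) :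
  exists (s : nat) (q : 'I_s -> A -> Prop),
    good_family q /\
        (* (1) and (3): a = q_1 ... q_s, unique *)
        eqI a (prodF q) /\
        (forall (t : nat) (r : 'I_t -> A -> Prop),
            good_family r -> eqI a (prodF r) -> same_up_to_perm q r) /\
        (* (2) and (3): a = q_1 cap ... cap q_s, unique *)
        eqI a (capF q) /\
        (forall (t : nat) (r : 'I_t -> A -> Prop),
            good_family r -> eqI a (capF r) -> same_up_to_perm q r) /\
        (* (4): {q_1,...,q_s} = Min(a) *)
        (forall P, min_prime_over a P <-> exists i, eqI P (q i)) /\
        (forall P, min_prime_over a P -> idempotent_ideal P).
Proof.
have [[yx1 comm_rel] gen univ] := HS.
have xxC i j : GRing.comm (x i) (x j).
  by have [->//|/comm_rel[]] := eqVneq i j.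
have yyC i j : GRing.comm (y i) (y j).
  by have [->//|/comm_rel[]] := eqVneq i j.
have xyC i j : i != j -> GRing.comm (x i) (y j) by case/comm_rel.
have genT z : subalg x y setT setT z.
  apply: gen => [|b c|b c|k b|i].
  - exact: subalg1.
  - exact: subalgD.
  - exact: subalgM.
  - exact: subalgZ.
  - by split; [apply: subalgX|apply: subalgY]; rewrite inE.
have [s [q [Hq acap cap_prod]]] := idem_decomposition yx1 xxC yyC xyC genT univ Ha.
have ideals m (r : 'I_m -> A -> Prop) (Hr : good_family r) i : is_ideal (r i).
  by have [[[]]] := Hr.1 i.
have prod_cap m (r : 'I_m -> A -> Prop) : good_family r -> subI (prodF r) (capF r).
  move=> Hr z Hz i; apply: prodI_sub Hz; first exact: ideals.
  by rewrite mem_enum.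
have aprod : eqI a (prodF q).
  by move=> z; split=> [/acap/cap_prod|/prod_cap H] //; apply/acap/H.
have aq i : subI a (q i) by move=> z /acap.
have qa : subI (prodF q) a by move=> z /aprod.
(* A prime over [a] contains the product of the [q i], hence one of them. *)
have below P : prime_ideal P -> subI a P -> exists i, subI (q i) P.
  move=> HP aP.
  have [||i _ qP] := @prime_prodI _ _ _ q _ P (enum 'I_s) HP; last by exists i.
    exact: ideals.
  by move=> z /qa /aP.
have minq P : min_prime_over a P <-> exists i, eqI P (q i).
  split=> [[HP aP minP]|[i Pq]].
    have [i qP] := below P HP aP; exists i => z; split; last exact: qP.
    exact: minP (Hq.1 i).1 (aq i) qP z.
  have -> : P = q i by apply/predeqP.
  split=> [||Q HQ aQ Qq]; [exact: (Hq.1 i).1|exact: aq|].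
  have [k qQ] := below Q HQ aQ.
  have [ki|/Hq.2[[]]] := eqVneq k i; last by move=> z /qQ /Qq.
  by rewrite ki in qQ.
exists s, q; split=> //; split=> //; split.
  (* For a product, [a] lies in each [r j] because the product is inside the intersection; for an
     intersection, below, the same inclusion puts the product inside [a]. *)
  move=> t r Hr ar; apply: (good_family_unique Hq Hr aq _ qa) => [j|] z; last by move/ar.
  by move=> /ar /(prod_cap _ _ Hr)/(_ j).
split=> //; split.
  move=> t r Hr ar; apply: (good_family_unique Hq Hr aq _ qa) => [j|] z; first by move/ar.
  by move=> /(prod_cap _ _ Hr)/ar.
split=> // P /minq[i /predeqP->]; exact: (Hq.1 i).2.
Qed.
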